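(* Let $M\subset\mathbb{R}^m$ be a parametric domain, let $P_1,\dots,P_r$ be families of probability density functions over the same parametric domain $M$, with spatial domains $X_1,\dots,X_r$ respectively, and let $e_1,\dots,e_r\in\mathbb{N}^{+}$ be positive integers. Let $$P=\bigodot_{i=1}^r P_i^{\odot e_i}$$ be the spatially disjoint product in which each $P_i$ occurs $e_i$ times (each occurrence in its own separate spatial variables). Then for all $a,b\in\{1,\dots,m\}$, as functions on $M$, $$g_{ab}\Big(\bigodot_{i=1}^r P_i^{\odot e_i}\Big)=\sum_{i=1}^r e_i\, g_{ab}(P_i),$$ where $g_{ab}(\cdot)$ denotes the components of the Fisher information metric.
   Context: A family of probability density functions with spatial domain $X\subset\mathbb{R}^n$ (a nonempty connected open set) and parametric domain $M\subset\mathbb{R}^m$ (open) is a function $P:X\times M\to\mathbb{R}$, $P\ge 0$, such that for each $\theta\in M$ the function $P(\cdot;\theta)$ is continuous on $X$, the derivatives $\partial_a P=\partial P/\partial\theta^a$ exist and are continuous on $X$, and $\int_X P(x;\theta)\,\mathrm{d}x=1$. Standing regularity: differentiation in $\theta$ and integration over $X$ may be exchanged for each such family, i.e. $\int_X\partial_aP(x;\theta)\,\mathrm{d}x=\partial_a\int_XP(x;\theta)\,\mathrm{d}x$ (the left-hand integral converging absolutely). The Fisher information metric of $P$ is $$g_{ab}(P)(\theta)=\int_X P(x;\theta)\,\partial_a\ln P(x;\theta)\,\partial_b\ln P(x;\theta)\,\mathrm{d}x ,$$ where the integrand is taken to be $0$ at points where $P(x;\theta)=0$; for the given families $P_i$ these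 integrals are assumed to converge absolutely. The spatially disjoint product of $P_1:X_1\times M\to\mathbb{R}$ with $X_1\subset\mathbb{R}^{k}$ and $P_2:X_2\times M\to\mathbb{R}$ with $X_2\subset\mathbb{R}^{n}$ is the function $P_1\odot P_2:(X_1\times X_2)\times M\to\mathbb{R}$ given by $$(P_1\odot P_2)(x^1,\dots,x^{k+n};\theta)=P_1(x^1,\dots,x^k;\theta)\,P_2(x^{k+1},\dots,x^{k+n};\theta).$$ $P^{\odot e}$ denotes $P\odot\cdots\odot P$ ($e$ factors), and $\bigodot$ denotes the iterated product. *)

(* Defs.v *)
From HB Require Import structures.
From mathcomp Require Import all_boot all_order all_algebra.
From mathcomp Require Import all_classical all_reals all_analysis.

Set Implicit Arguments.
Unset Strict Implicit.
Unset Printing Implicit Defensive.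

Import Order.TTheory GRing.Theory Num.Theory.
Import numFieldNormedType.Exports.

Local Open Scope classical_set_scope.
Local Open Scope ring_scope.

Section measurable_rV.
Variables (R : realType) (n : nat).

Let coor : 'I_n -> 'rV[R]_n -> measurableTypeR R := fun i x => x ord0 i.

Let rV_set0 : g_sigma_preimage coor set0.
Proof. exact: sigma_algebra0. Qed.

Let rV_setC A : g_sigma_preimage coor A -> g_sigma_preimage coor (~` A).
Proof. exact: sigma_algebraC. Qed.

Let rV_bigcup (F : _^nat) : (forall i, g_sigma_preimage coor (F i)) ->
  g_sigma_preimage coor (\bigcup_i (F i)).
Proof. exact: sigma_algebra_bigcup. Qed.

(* The product sigma-algebra on R^n; it contains the open sets (see
   [open_measurable_rV] below), so it is the Borel sigma-algebra. *)
HB.instance Definition _ := @isMeasurable.Build default_measure_display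
  'rV[R]_n (g_sigma_preimage coor) rV_set0 rV_setC rV_bigcup.

Lemma measurable_coor (i : 'I_n) : measurable_fun [set: 'rV[R]_n] (coor i).
Proof.
move=> _ Y mY; rewrite setTI; apply: sub_sigma_algebra => /=.
rewrite -bigcup_seq/=; exists i => /=; first by rewrite mem_index_enum.
by exists Y => //; rewrite setTI.
Qed.

Lemma measurable_fun_coorP d (T : measurableType d) (f : T -> 'rV[R]_n) :
  (forall i, measurable_fun [set: T] (coor i \o f)) ->
  measurable_fun [set: T] f.
Proof.
move=> mf _ A mA; rewrite setTI.
suff : @g_sigma_preimage _ _ T n (fun i => coor i \o f) `<=` measurable.
  apply; rewrite g_sigma_preimage_comp.
  by exists A => //; rewrite setTI.
apply: smallest_sub; first exact: sigma_algebra_measurable.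
case: (n) coor f mf => [|k] c f mf; first by rewrite big_ord0.
rewrite -bigcup_mkord_ord; apply: bigcup_sub => i Ii.
by move=> B [C mC <-]; exact: mf.
Qed.

End measurable_rV.

Section cons_rV.
Variables (R : realType) (n : nat).

Definition cons_rV (p : measurableTypeR R * 'rV[R]_n) : 'rV[R]_n.+1 :=
  row_mx (p.1%:M : 'M[R]_1) p.2.

Definition uncons_rV (x : 'rV[R]_n.+1) : measurableTypeR R * 'rV[R]_n :=
  (x ord0 ord0, @rsubmx _ 1 1 n x).

Lemma cons_rV0 p : cons_rV p ord0 ord0 = p.1.
Proof.
have -> : ord0 = lshift n (ord0 : 'I_1) :> 'I_n.+1 by exact/val_inj.
by rewrite [LHS](@row_mxEl _ 1 1 n) mxE eqxx mulr1n.
Qed.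

Lemma cons_rVS p (i : 'I_n) : cons_rV p ord0 (lift ord0 i) = p.2 ord0 i.
Proof.
have -> : lift ord0 i = rshift 1 i :> 'I_n.+1 by exact/val_inj.
by rewrite [LHS](@row_mxEr _ 1 1 n).
Qed.

Lemma uncons_rVK : cancel uncons_rV cons_rV.
Proof.
move=> x; apply: etrans (@hsubmxK _ 1 1 n x).
rewrite /cons_rV /=; congr (@row_mx _ 1 1 n _ _).
apply/rowP => i; rewrite !mxE !ord1 mulr1n /=.
by congr (x _ _); apply/val_inj.
Qed.

Lemma cons_rVK : cancel cons_rV uncons_rV.
Proof. by case=> t v; rewrite /uncons_rV cons_rV0 /cons_rV row_mxKr. Qed.

Lemma measurable_cons_rV : measurable_fun setT cons_rV.
Proof.
apply: measurable_fun_coorP => i.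
have [->|[j ->]] : i = ord0 \/ exists j, i = lift ord0 j.
  by case: (unliftP ord0 i) => [j ->|->]; [right; exists j|left].
- rewrite (_ : _ \o _ = fst); first exact: measurable_fst.
  by apply/funext => p /=; rewrite cons_rV0.
- rewrite (_ : _ \o _ = (fun x : 'rV[R]_n => x ord0 j) \o snd).
    by apply: measurableT_comp; [exact: measurable_coor|exact: measurable_snd].
  by apply/funext => p /=; rewrite cons_rVS.
Qed.

Lemma measurable_uncons_rV : measurable_fun setT uncons_rV.
Proof.
apply: measurable_fun_pair; first exact: measurable_coor.
apply: measurable_fun_coorP => i.
rewrite (_ : _ \o _ = fun x : 'rV[R]_n.+1 => x ord0 (rshift 1 i)).
  exact: measurable_coor.
by apply/funext => x /=; rewrite mxE.
Qed.

Variable mu : {sigma_finite_measure set 'rV[R]_n -> \bar R}.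

Definition lebesgue_cons : set 'rV[R]_n.+1 -> \bar R :=
  pushforward (@lebesgue_measure R \x mu)%E cons_rV.

Let lebesgue_cons0 : lebesgue_cons set0 = 0%E.
Proof. by rewrite /lebesgue_cons /pushforward preimage_set0 measure0. Qed.

Let lebesgue_cons_ge0 A : (0 <= lebesgue_cons A)%E.
Proof. by rewrite /lebesgue_cons /pushforward; exact: measure_ge0. Qed.

Let lebesgue_cons_sigma_additive : semi_sigma_additive lebesgue_cons.
Proof.
move=> F mF tF mUF; rewrite /lebesgue_cons /pushforward preimage_bigcup.
have mK A : measurable A -> measurable (cons_rV @^-1` A).
  by move=> mA; rewrite -[X in measurable X]setTI; exact: measurable_cons_rV.
apply: measure_semi_sigma_additive.
- by move=> k; exact: mK.
- apply/trivIsetP => /= i j _ _ ij; rewrite -preimage_setI.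
  by move/trivIsetP : tF => /(_ _ _ _ _ ij) ->//; rewrite preimage_set0.
- by rewrite -preimage_bigcup; exact: mK.
Qed.

HB.instance Definition _ := isMeasure.Build _ _ _ lebesgue_cons
  lebesgue_cons0 lebesgue_cons_ge0 lebesgue_cons_sigma_additive.

Let lebesgue_cons_sigma_finite : sigma_finite setT lebesgue_cons.
Proof.
have /sigma_finiteP[F [FT ndF Foo]] := sigma_finiteT (@lebesgue_measure R).
have /sigma_finiteP[G [GT ndG Goo]] := sigma_finiteT mu.
exists (fun k => uncons_rV @^-1` (F k `*` G k)).
  apply/seteqP; split => // x _.
  have : (\bigcup_k F k) (uncons_rV x).1 by rewrite -FT.
  have : (\bigcup_k G k) (uncons_rV x).2 by rewrite -GT.
  move=> [k _ Gk] [l _ Fl]; exists (maxn k l) => //; split.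
    by move: Fl; exact/subsetPset/ndF/leq_maxr.
  by move: Gk; exact/subsetPset/ndG/leq_maxl.
move=> k; have [mF Fk] := Foo k; have [mG Gk] := Goo k; split.
  rewrite -[X in measurable X]setTI; apply: measurable_uncons_rV => //.
  exact: measurableX.
rewrite /lebesgue_cons /pushforward -comp_preimage.
rewrite (_ : uncons_rV \o cons_rV = id); last exact/funext/cons_rVK.
by rewrite preimage_id product_measure1E// lte_mul_pinfty// ge0_fin_numE.
Qed.

HB.instance Definition _ := Measure_isSigmaFinite.Build _ _ _ lebesgue_cons
  lebesgue_cons_sigma_finite.

End cons_rV.

Fixpoint lebesgue_rV (R : realType) (n : nat) :
    {sigma_finite_measure set 'rV[R]_n -> \bar R} :=
  match n with
  | 0 => \d_(0 : 'rV[R]_0)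
  | k.+1 => lebesgue_cons (lebesgue_rV R k)
  end.

Lemma lebesgue_rV_box (R : realType) n (A : 'I_n -> set R) :
  (forall i, measurable (A i)) ->
  lebesgue_rV R n [set x | forall i, A i (x ord0 i)] =
  (\prod_(i < n) lebesgue_measure (A i))%E.
Proof.
elim: n A => [|n IH] A mA.
  rewrite big_ord0 /= /dirac /= indicE mem_set//; by case.
have mbox : measurable [set x : 'rV[R]_n | forall i, A (lift ord0 i) (x ord0 i)].
  rewrite [X in measurable X](_ : _ = \big[setI/setT]_(i < n)
      ((fun x : 'rV[R]_n => x ord0 i) @^-1` A (lift ord0 i))).
    apply: bigsetI_measurable => i _.
    rewrite -[X in measurable X]setTI; apply: measurable_coor => //.
    exact: mA.
  apply/seteqP; split => x /=.
    by move=> H; elim/big_ind: _ => // i _; exact: H.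
  by move=> H i; move: H; rewrite (bigD1 i)//= => -[].
rewrite big_ord_recl /= /lebesgue_cons /pushforward -IH//.
rewrite -product_measure1E//; last exact: (mA ord0).
congr (_ _); apply/seteqP; split => p /=.
  move=> H; split; first by rewrite -(cons_rV0 p); exact: H.
  by move=> i; rewrite -cons_rVS; exact: H.
move=> [H0 HS] i; case: (unliftP ord0 i) => [j ->|->].
  by rewrite cons_rVS; exact: HS.
by rewrite cons_rV0.
Qed.

Lemma open_measurable_rV (R : realType) (n : nat) (O : set 'rV[R]_n) :
  open O -> measurable O.
Proof.
move=> oO.
pose B (p : 'rV[rat]_n * 'rV[rat]_n) := [set x : 'rV[R]_n |
  forall i, x ord0 i \in `](ratr (p.1 ord0 i)), (ratr (p.2 ord0 i))[].
rewrite (_ : O = \bigcup_p (if pselect (B p `<=` O) then B p else set0)).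
  apply: countable_bigcupT_measurable => [|p]; first exact: countableP.
  case: (pselect (B p `<=` O)) => [BO|nBO] /=; last exact: measurable0.
  rewrite (_ : B p = \big[setI/setT]_(i < n) ((fun x : 'rV[R]_n => x ord0 i) @^-1`
      [set` `](ratr (p.1 ord0 i)), (ratr (p.2 ord0 i))[])).
    apply: bigsetI_measurable => i _.
    rewrite -[X in measurable X]setTI; apply: measurable_coor => //.
  apply/seteqP; split => x /=.
    by move=> H; elim/big_ind: _ => // i _; exact: H.
  by move=> H i; move: H; rewrite (bigD1 i)//= => -[].
apply/seteqP; split => [x Ox|x [p _]]; last first.
  by case: (pselect (B p `<=` O)) => BO //= Bx; exact: BO.
have /nbhs_ballP[e /= e0 eO] : nbhs x O by exact: open_nbhs_nbhs.
have /choice[a Ha] : forall i, exists q : rat,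
    ratr q \in `](x ord0 i - e), (x ord0 i)[.
  by move=> i; apply: rat_in_itvoo; rewrite ltrBlDr ltrDl.
have /choice[b Hb] : forall i, exists q : rat,
    ratr q \in `](x ord0 i), (x ord0 i + e)[.
  by move=> i; apply: rat_in_itvoo; rewrite ltrDl.
exists (\row_i a i, \row_i b i) => //; case: (pselect (B _ `<=` O)) => [BO|[]] /=.
  by move=> i; rewrite !mxE /= in_itv/=; move: (Ha i) (Hb i);
    rewrite !in_itv/= => /andP[_ ->] /andP[-> _].
move=> y By; apply: eO; split => // i j; rewrite ord1.
have := By j; rewrite !mxE /= !in_itv/= => /andP[ay yb].
move: (Ha j) (Hb j); rewrite !in_itv/= => /andP[xa _] /andP[_ bx].
rewrite /ball/= ltr_distl; apply/andP; split.
  by rewrite ltrBlDr; exact: lt_trans yb bx.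
by rewrite -ltrBlDr; exact: lt_trans xa ay.
Qed.

Section pdf_families.
Variables (R : realType) (m : nat).

Definition partial (a : 'I_m) (f : 'rV[R]_m -> R) (theta : 'rV[R]_m) : R :=
  'D_(delta_mx ord0 a) f theta.

(* A function P : X x M -> R together with its spatial domain X in R^n.  The
   values of [dens] outside of X x M are irrelevant. *)
Record spatial_fun := SpatialFun {
  sdim : nat ;
  sdom : set 'rV[R]_sdim ;
  dens : 'rV[R]_sdim -> 'rV[R]_m -> R }.

Arguments sdom : clear implicits.
Arguments dens : clear implicits.

Local Notation leb P := (lebesgue_rV R (sdim P)).

Record is_pdf_family (M : set 'rV[R]_m) (P : spatial_fun) : Prop := {
  sdom_open : open (sdom P) ;
  sdom_nonempty : sdom P !=set0 ;
  sdom_connected : connected (sdom P) ;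
  dens_ge0 : forall x theta, sdom P x -> M theta -> 0 <= dens P x theta ;
  dens_continuous : forall theta, M theta ->
    {within sdom P, continuous (dens P ^~ theta)} ;
  dens_derivable : forall (a : 'I_m) x theta, sdom P x -> M theta ->
    derivable (dens P x) theta (delta_mx ord0 a) ;
  partial_dens_continuous : forall a theta, M theta ->
    {within sdom P, continuous (fun x => partial a (dens P x) theta)} ;
  integral_dens : forall theta, M theta ->
    (\int[leb P]_(x in sdom P) (dens P x theta)%:E = 1)%E ;
  partial_dens_integrable : forall a theta, M theta ->
    (leb P).-integrable (sdom P)
      (fun x => (partial a (dens P x) theta)%:E) ;
  partial_integral_exchange : forall a theta, M theta ->
    \int[leb P]_(x in sdom P) partial a (dens P x) theta =
    partial a (fun t => \int[leb P]_(x in sdom P) dens P x t) theta }.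

(* The first factor makes this 0 wherever [dens P x theta = 0]. *)
Definition fisher_integrand (P : spatial_fun) (a b : 'I_m)
    (theta : 'rV[R]_m) (x : 'rV[R]_(sdim P)) : R :=
  dens P x theta * partial a (fun t => ln (dens P x t)) theta
                 * partial b (fun t => ln (dens P x t)) theta.

Arguments fisher_integrand : clear implicits.

Definition fisher (P : spatial_fun) (a b : 'I_m) (theta : 'rV[R]_m) : \bar R :=
  (\int[leb P]_(x in sdom P) (fisher_integrand P a b theta x)%:E)%E.

Definition fisher_converges (M : set 'rV[R]_m) (P : spatial_fun) : Prop :=
  forall a b theta, M theta ->
    (leb P).-integrable (sdom P)
      (fun x => (fisher_integrand P a b theta x)%:E).

Definition odot (P Q : spatial_fun) : spatial_fun := {|
  sdim := sdim P + sdim Q ;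
  sdom := [set x | sdom P (lsubmx x) /\ sdom Q (rsubmx x)] ;
  dens := fun x theta => dens P (lsubmx x) theta * dens Q (rsubmx x) theta |}.

(* P (.) ... (.) P with e factors, for e > 0, nested to the left *)
Definition odot_pow (P : spatial_fun) (e : nat) : spatial_fun :=
  iter e.-1 (odot^~ P) P.

(* Q_0 (.) ... (.) Q_r, nested to the left *)
Definition bigodot (r : nat) (Q : 'I_r.+1 -> spatial_fun) : spatial_fun :=
  foldl odot (Q ord0) [seq Q (lift ord0 i) | i <- enum 'I_r].

End pdf_families.

(* Main.v *)
(** Write p, q for the densities of P and Q at theta.  The Fisher integrand of P
    is I_P = (d_a p)(d_b p) / p, read as 0 where p = 0.  Wherever p = 0, the map
    t |-> P(x; t) has a minimum at theta, so the partial derivatives of P vanish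
    there too; hence the Fisher integrand of the product P (.) Q is, pointwise,
      I_P q + (d_a p)(d_b q) + (d_b p)(d_a q) + p I_Q.
    Each summand separates the variables, so Fubini applies: p and q have
    integral 1, and the integrals of their derivatives vanish because they are
    the derivatives of the constant 1.  Hence g(P (.) Q) = g(P) + g(Q). *)
Require Import Defs.
From mathcomp Require Import all_boot all_order all_algebra.
From mathcomp Require Import all_classical all_reals all_analysis.
From mathcomp Require Import measurable_realfun ring.

Set Implicit Arguments.
Unset Strict Implicit.
Unset Printing Implicit Defensive.

Import Order.TTheory GRing.Theory Num.Theory.
Import numFieldNormedType.Exports.

Local Open Scope classical_set_scope.
Local Open Scope ring_scope.

(** * Lebesgue measure on ['rV[R]_(k + n)] as a product measure *)

Section split_rV.
Variables (R : realType) (k n : nat).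

Definition split_rV (x : 'rV[R]_(k + n)) : 'rV[R]_k * 'rV[R]_n :=
  (lsubmx x, rsubmx x).

Lemma measurable_split_rV : measurable_fun setT split_rV.
Proof.
apply: measurable_fun_pair; apply: measurable_fun_coorP => i.
  rewrite (_ : _ \o _ = fun x : 'rV[R]_(k + n) => x ord0 (lshift n i)).
    exact: measurable_coor.
  by apply/funext => x /=; rewrite mxE.
rewrite (_ : _ \o _ = fun x : 'rV[R]_(k + n) => x ord0 (rshift k i)).
  exact: measurable_coor.
by apply/funext => x /=; rewrite mxE.
Qed.

End split_rV.

Lemma lsubmx_cons_rV (R : realType) k n t (z : 'rV[R]_(k + n)) :
  lsubmx (cons_rV (t, z) : 'rV[R]_(k.+1 + n)) = cons_rV (t, lsubmx z).
Proof.
apply/rowP => i; rewrite [LHS]mxE; case: (unliftP ord0 i) => [j ->|->].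
  rewrite [RHS]cons_rVS /= [RHS]mxE -[RHS](cons_rVS (t, z)).
  by congr (cons_rV _ _ _); exact/val_inj.
rewrite [RHS]cons_rV0 -[RHS]/((t, z).1) -[RHS](cons_rV0 (t, z)).
by congr (cons_rV _ _ _); exact/val_inj.
Qed.

Lemma rsubmx_cons_rV (R : realType) k n t (z : 'rV[R]_(k + n)) :
  rsubmx (cons_rV (t, z) : 'rV[R]_(k.+1 + n)) = rsubmx z.
Proof.
apply/rowP => i; rewrite [LHS]mxE [RHS]mxE -[RHS](cons_rVS (t, z)).
by congr (cons_rV _ _ _); exact/val_inj.
Qed.

(** Induction on [k], following the recursive construction of [lebesgue_rV], which adds one leading
    coordinate at a time. For [k = 0] the left factor is a Dirac mass at the only vector, so its
    value is 1 or 0 according to whether [A] contains 0. *)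
Lemma lebesgue_rV_setX (R : realType) k n (A : set 'rV[R]_k) (B : set 'rV[R]_n) :
  measurable A -> measurable B ->
  lebesgue_rV R (k + n) (@split_rV R k n @^-1` (A `*` B)) =
  (lebesgue_rV R k A * lebesgue_rV R n B)%E.
Proof.
elim: k A => [|k IH] A mA mB.
  rewrite /= /dirac indicE.
  have splitE (x : 'rV[R]_(0 + n)) : @split_rV R 0 n x = (0, x).
    congr (_, _); first exact: thinmx0.
    by apply/rowP => i; rewrite mxE; congr (x _ _); exact/val_inj.
  rewrite (_ : _ @^-1` _ = [set x | A 0 /\ B x]); last first.
    by apply/seteqP; split => x; rewrite /preimage/mkset splitE.
  have [A0|A0] := pselect (A 0).
    rewrite mem_set// mul1e; congr (lebesgue_rV R n _).
    by apply/seteqP; split => x //= [].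
  rewrite memNset// mul0e (_ : [set x | _] = set0) ?measure0//.
  by apply/seteqP; split => x //= [].
have mA' : measurable (@cons_rV R k @^-1` A).
  by rewrite -[X in measurable X]setTI; exact: measurable_cons_rV.
(* The product measure integrates the measures of the sections over the first coordinate [t]. The
   section of a rectangle at [t] is again a rectangle, with [A] replaced by its section, so the
   induction hypothesis applies and the constant measure of [B] leaves the integral. *)
rewrite /= /lebesgue_cons /pushforward /product_measure1.
under eq_integral => t _.
  rewrite (_ : (_ \o _) t = (lebesgue_rV R k (xsection (@cons_rV R k @^-1` A) t)
      * lebesgue_rV R n B)%E); last first.
    rewrite /= -IH//; last exact: measurable_xsection.
    congr (lebesgue_rV R _ _); apply/seteqP; split => z;
      by rewrite /xsection /= !inE /= lsubmx_cons_rV rsubmx_cons_rV.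
  over.
rewrite ge0_integralZr//.
exact: measurable_fun_xsection.
Qed.

(** * Fubini for products with separated variables, transported along a map *)

Section integral_product.
Local Open Scope ereal_scope.
Context d1 d2 (T1 : measurableType d1) (T2 : measurableType d2) (R : realType).
Variable m1 : {sigma_finite_measure set T1 -> \bar R}.
Variable m2 : {sigma_finite_measure set T2 -> \bar R}.

(** By Tonelli it suffices that the iterated integral of the absolute value is finite; it factors
    into two finite integrals. *)
Lemma integrable_prodM (f : T1 -> R) (g : T2 -> R) :
  m1.-integrable setT (EFin \o f) -> m2.-integrable setT (EFin \o g) ->
  (m1 \x m2).-integrable setT (fun z => (f z.1 * g z.2)%:E).
Proof.
move=> intf intg.
have mf : measurable_fun setT f by apply/measurable_EFinP/(measurable_int m1).
have mg : measurable_fun setT g by apply/measurable_EFinP/(measurable_int m2).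
apply/integrable12ltyP.
  apply/measurable_EFinP; apply: measurable_funM.
    by apply: measurableT_comp => //; exact: measurable_fst.
  by apply: measurableT_comp => //; exact: measurable_snd.
under eq_integral => x _.
  under eq_integral => y _ do rewrite /= normrM EFinM.
  rewrite ge0_integralZl//; last first.
    by apply/measurable_EFinP; exact: measurableT_comp.
  over.
rewrite /= ge0_integralZr//; last 2 first.
- by apply/measurable_EFinP; exact: measurableT_comp.
- by apply: integral_ge0 => y _; rewrite lee_fin.
move/integrableP: intf => [_ intf]; move/integrableP: intg => [_ intg].
by apply: lte_mul_pinfty => //; [exact: integral_ge0|rewrite ge0_fin_numE//;
  exact: integral_ge0].
Qed.

Lemma integral_prodM (f : T1 -> R) (g : T2 -> R) :
  m1.-integrable setT (EFin \o f) -> m2.-integrable setT (EFin \o g) ->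
  \int[m1 \x m2]_z (f z.1 * g z.2)%:E =
  \int[m1]_x (f x)%:E * \int[m2]_y (g y)%:E.
Proof.
move=> intf intg.
rewrite -integral12_prod_meas1; last exact: integrable_prodM.
transitivity (\int[m1]_x ((f x)%:E * \int[m2]_y (g y)%:E)).
  by apply: eq_integral => x _; rewrite -integralZl.
(* The integral of [g] is finite, so it can be pulled out as a real constant. *)
have /fineK <- := integrable_fin_num measurableT intg.
by rewrite integralZr.
Qed.

Context d (X : measurableType d) (mu : {measure set X -> \bar R}).
Variable phi : X -> T1 * T2.
Hypothesis mphi : measurable_fun setT phi.
Hypothesis muphi : forall A B, measurable A -> measurable B ->
  mu (phi @^-1` (A `*` B)) = m1 A * m2 B.

(** By [muphi] the image of [mu] under [phi] agrees with the product measure on measurable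
    rectangles, and this determines the product of sigma-finite measures. *)
Let pushforwardE (h : T1 * T2 -> \bar R) :
  \int[m1 \x m2]_z h z = \int[pushforward mu phi]_z h z.
Proof.
apply: eq_measure_integral => A mA _.
by apply: product_measure_unique.
Qed.

Let integrable_comp (h : T1 * T2 -> \bar R) :
  (m1 \x m2).-integrable setT h -> mu.-integrable setT (h \o phi).
Proof.
move=> /integrableP[mh ih]; apply/integrableP; split.
  exact: measurableT_comp.
move: ih; rewrite pushforwardE ge0_integral_pushforward//.
exact: measurableT_comp.
Qed.

Let integral_comp (h : T1 * T2 -> \bar R) :
  (m1 \x m2).-integrable setT h -> \int[mu]_x h (phi x) = \int[m1 \x m2]_z h z.
Proof.
move=> ih; rewrite pushforwardE [RHS]integral_pushforward//.
- by case/integrableP: ih.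
- exact: integrable_comp.
Qed.

Variables (D1 : set T1) (D2 : set T2) (f : T1 -> R) (g : T2 -> R).
Hypotheses (mD1 : measurable D1) (mD2 : measurable D2).
Hypotheses (intf : m1.-integrable D1 (EFin \o f))
           (intg : m2.-integrable D2 (EFin \o g)).

(** Extension by zero keeps the variables separated, which reduces integrals over [D1] and [D2] to
    integrals over the whole spaces. *)
Let restrictM :
  (fun x => (f (phi x).1 * g (phi x).2)%:E) \_ (phi @^-1` (D1 `*` D2)) =
  (fun z => ((f \_ D1) z.1 * (g \_ D2) z.2)%:E) \o phi.
Proof.
apply/funext => x; rewrite /= /patch.
case: ifPn => [|].
  by rewrite inE /= => -[D1x D2x]; rewrite !mem_set.
move=> /negP xD; case: ifPn => D1x; last by rewrite mul0r.
case: ifPn => D2x; last by rewrite mulr0.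
by exfalso; apply: xD; rewrite !inE in D1x D2x *; split.
Qed.

Let intf' : m1.-integrable setT (EFin \o (f \_ D1)).
Proof. by rewrite -restrict_EFin; exact/(integrable_mkcond _ _).1. Qed.

Let intg' : m2.-integrable setT (EFin \o (g \_ D2)).
Proof. by rewrite -restrict_EFin; exact/(integrable_mkcond _ _).1. Qed.

Lemma integrable_preimageM :
  mu.-integrable (phi @^-1` (D1 `*` D2)) (fun x => (f (phi x).1 * g (phi x).2)%:E).
Proof.
apply/integrable_mkcond.
  rewrite -[X in measurable X]setTI; apply: mphi => //; exact: measurableX.
rewrite restrictM; apply: integrable_comp; exact: integrable_prodM.
Qed.

Lemma integral_preimageM :
  \int[mu]_(x in phi @^-1` (D1 `*` D2)) (f (phi x).1 * g (phi x).2)%:E =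
  \int[m1]_(x in D1) (f x)%:E * \int[m2]_(y in D2) (g y)%:E.
Proof.
rewrite integral_mkcond restrictM.
rewrite (integral_comp (integrable_prodM intf' intg')) integral_prodM//.
by congr (_ * _); rewrite [RHS]integral_mkcond restrict_EFin.
Qed.

End integral_product.

(** * Measurability of continuous functions and directional derivatives *)

Lemma within_continuous_measurable_rV (R : realType) n (D : set 'rV[R]_n)
    (f : 'rV[R]_n -> R) :
  open D -> {within D, continuous f} -> measurable_fun D f.
Proof.
move=> oD; rewrite continuous_open_subspace// => /(continuous_inP _ oD) cf.
(* Open intervals generate the Borel sets of the line, so it is enough that their preimages within
   [D] are open. *)
apply: (measurability _ (RGenOpens.measurableE R)) => _ [_ [a [b ->]] <-].
by apply: open_measurable_rV; exact/cf/interval_open.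
Qed.

Section derive_along_line.
Variables (R : realType) (V : normedModType R).
Implicit Types (f : V -> R) (x v : V).

(** Restricting to the line through [x] makes the one-variable chain rule available for the
    logarithm. *)
Lemma derive_lineE f x v : 'D_v f x = 'D_1 (fun h : R => f (h *: v + x)) 0.
Proof.
rewrite /derive; set g1 := fun h => h^-1 *: _; set g2 := fun h => h^-1 *: _.
suff -> : g1 = g2 by [].
by apply/funext => h; rewrite /g1 /g2 /= addr0 scale0r add0r [_%:A]mulr1.
Qed.

Lemma derive_ln f x v : derivable f x v -> 0 < f x ->
  'D_v (fun y => ln (f y)) x = 'D_v f x / f x.
Proof.
move=> df fx0; rewrite 2!derive_lineE -!derive1E.
rewrite (derive1_comp (g := @ln R)); last 2 first.
- by move: df => /derivable1P.
- by rewrite scale0r add0r; have [] := is_derive1_ln fx0.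
rewrite scale0r add0r mulrC; congr (_ * _).
by rewrite derive1E; have [_ ->] := is_derive1_ln fx0.
Qed.

(** At a local minimum the difference quotients are nonpositive from the left and nonnegative from
    the right, and both one-sided limits equal the derivative. *)
Lemma derive_min_eq0 f x v : derivable f x v -> f x = 0 ->
  (\forall y \near x, 0 <= f y) -> 'D_v f x = 0.
Proof.
move=> df fx0 f0.
have f0' : \forall h \near (0 : R), 0 <= f (h *: v + x).
  have : h *: v + x @[h --> (0 : R)] --> x.
    rewrite -[X in _ --> X]add0r -[X in _ --> X + _](scale0r v).
    by apply: cvgD; [apply: cvgZr_tmp; exact: cvg_id|exact: cvg_cst].
  by move=> /(_ _ f0).
have dq : h^-1 *: (f (h *: v + x) - f x) @[h --> 0^'] --> 'D_v f x by exact: df.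
apply/eqP; rewrite eq_le; apply/andP; split.
  have dl := cvg_dnbhs_at_left dq.
  rewrite -(cvg_lim _ dl)//; apply: limr_le; first exact: cvgP dl.
  near=> h; rewrite fx0 subr0; apply: mulr_le0_ge0.
    by rewrite invr_le0; near: h; exact: nbhs_left_le.
  near: h; exact: cvg_within f0'.
have dr := cvg_dnbhs_at_right dq.
rewrite -(cvg_lim _ dr)//; apply: limr_ge; first exact: cvgP dr.
near=> h; rewrite fx0 subr0; apply: mulr_ge0.
  by rewrite invr_ge0; near: h; exact: nbhs_right_ge.
near: h; exact: cvg_within f0'.
Unshelve. all: by end_near. Qed.

End derive_along_line.

Arguments sdom {R m} s.
Arguments dens {R m} s.
Arguments fisher_integrand {R m} P.

(** * Integrals of sums of four terms *)

Section integral_sum4.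
Local Open Scope ereal_scope.
Context dsp (T : measurableType dsp) (R : realType).
Variables (mu : {measure set T -> \bar R}) (D : set T) (mD : measurable D).
Variables f1 f2 f3 f4 : T -> R.
Hypotheses (i1 : mu.-integrable D (EFin \o f1)) (i2 : mu.-integrable D (EFin \o f2)).
Hypotheses (i3 : mu.-integrable D (EFin \o f3)) (i4 : mu.-integrable D (EFin \o f4)).

Let i12 : mu.-integrable D (EFin \o (f1 \+ f2)%R).
Proof. exact: (integrableD mD i1 i2). Qed.

Let i123 : mu.-integrable D (EFin \o (f1 \+ f2 \+ f3)%R).
Proof. exact: (integrableD mD i12 i3). Qed.

Lemma integrable_sum4 :
  mu.-integrable D (fun x => (f1 x + f2 x + f3 x + f4 x)%:E).
Proof. exact: (integrableD mD i123 i4). Qed.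

Lemma integral_sum4 :
  \int[mu]_(x in D) (f1 x + f2 x + f3 x + f4 x)%:E =
  \int[mu]_(x in D) (f1 x)%:E + \int[mu]_(x in D) (f2 x)%:E +
  \int[mu]_(x in D) (f3 x)%:E + \int[mu]_(x in D) (f4 x)%:E.
Proof.
by rewrite -(integralD_EFin mD i1 i2) -(integralD_EFin mD i12 i3)
  -(integralD_EFin mD i123 i4).
Qed.

End integral_sum4.

(** * Pointwise regularity and the Fisher integrand of a product *)

Section fisher_information.
Variables (R : realType) (m : nat) (theta : 'rV[R]_m).
Implicit Types P Q : spatial_fun R m.

Local Notation leb P := (lebesgue_rV R (sdim P)).
Local Notation d a P x := (partial a (dens P x) theta).

(* What the induction on the number of factors needs; unlike [is_pdf_family], it
   is a condition at the single point theta and is stable under [odot]. *)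
Record regular_at P : Prop := {
  reg_measurable : measurable (sdom P) ;
  reg_ge0 : forall x, sdom P x -> \forall t \near theta, 0 <= dens P x t ;
  reg_derivable : forall (a : 'I_m) x, sdom P x ->
    derivable (dens P x) theta (delta_mx ord0 a) ;
  reg_integrable : (leb P).-integrable (sdom P)
    (EFin \o (dens P ^~ theta)) ;
  reg_integral : (\int[leb P]_(x in sdom P) (dens P x theta)%:E = 1)%E ;
  reg_partial_integrable : forall a, (leb P).-integrable (sdom P)
    (EFin \o (fun x => d a P x)) ;
  reg_partial_integral : forall a,
    (\int[leb P]_(x in sdom P) (d a P x)%:E = 0)%E ;
  reg_fisher_integrable : forall a b, (leb P).-integrable (sdom P)
    (EFin \o fisher_integrand P a b theta) }.

Lemma pdf_family_regular_at (M : set 'rV[R]_m) P : open M -> M theta ->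
  is_pdf_family M P -> fisher_converges M P -> regular_at P.
Proof.
move=> oM Mt [oD _ _ ge0 cP dP _ intP ipP exch] fP.
have nM : \forall t \near theta, M t by exact: open_nbhs_nbhs.
have mD : measurable (sdom P) by exact: open_measurable_rV.
split => //.
- by move=> x Dx; near=> t; apply: ge0 => //; near: t.
- by move=> a x Dx; exact: dP.
- apply/integrableP; split.
    apply/measurable_EFinP; apply: within_continuous_measurable_rV => //.
    exact: cP.
  (* A density equals its absolute value on the domain, so the integral to be bounded is 1. *)
  rewrite (eq_integral (fun x => (dens P x theta)%:E)).
    by rewrite intP// ltry.
  by move=> x; rewrite inE => Dx /=; rewrite ger0_norm// ge0.
- exact: intP.
- by move=> a; exact: ipP.
- move=> a; rewrite -[LHS]fineK; last exact: integrable_fin_num (ipP a _ Mt).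
  congr (_%:E); have := exch a _ Mt; rewrite /Rintegral => ->.
  (* Since [M] is open, the total integral is constantly 1 near [theta], so its partial derivative
     is 0. *)
  rewrite /partial (@near_eq_derive R _ R _ (cst 1)) ?derive_cst//.
  near=> t; rewrite intP//; near: t; exact: nM.
- by move=> a b; exact: fP.
Unshelve. all: by end_near. Qed.

Lemma fisher_integrandE P a b x : 0 <= dens P x theta ->
  (forall c, derivable (dens P x) theta (delta_mx ord0 c)) ->
  fisher_integrand P a b theta x = d a P x * d b P x / dens P x theta.
Proof.
rewrite le_eqVlt /fisher_integrand => /predU1P[<- _|P0 dP].
  (* At a zero of the density both sides are 0, the right one because the inverse of 0 is 0. *)
  by rewrite invr0 !mul0r mulr0.
by rewrite /partial !derive_ln//; field; rewrite gt_eqF.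
Qed.

Lemma reg_fisher_integrandE P a b x : regular_at P -> sdom P x ->
  fisher_integrand P a b theta x = d a P x * d b P x / dens P x theta.
Proof.
move=> rP Dx; apply: fisher_integrandE; first exact: nbhs_singleton (reg_ge0 rP Dx).
by move=> c; exact: reg_derivable.
Qed.

Lemma partial_odot P Q a x : regular_at P -> regular_at Q -> sdom (odot P Q) x ->
  d a (odot P Q) x = d a P (lsubmx x) * dens Q (rsubmx x) theta
                   + dens P (lsubmx x) theta * d a Q (rsubmx x).
Proof.
move=> rP rQ [Px Qx]; rewrite /partial /=.
rewrite [LHS](deriveM (reg_derivable rP Px) (reg_derivable rQ Qx)).
by rewrite addrC; congr (_ + _); exact: mulrC.
Qed.

Lemma partial_eq0 P a x : regular_at P -> sdom P x ->
  dens P x theta = 0 -> d a P x = 0.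
Proof.
move=> rP Dx P0; apply: derive_min_eq0 => //; first exact: reg_derivable.
exact: reg_ge0.
Qed.

Lemma fisher_integrand_odot P Q a b x : regular_at P -> regular_at Q ->
  sdom (odot P Q) x ->
  fisher_integrand (odot P Q) a b theta x =
  fisher_integrand P a b theta (lsubmx x) * dens Q (rsubmx x) theta +
  d a P (lsubmx x) * d b Q (rsubmx x) +
  d b P (lsubmx x) * d a Q (rsubmx x) +
  dens P (lsubmx x) theta * fisher_integrand Q a b theta (rsubmx x).
Proof.
move=> rP rQ Dx; have [Px Qx] := Dx.
rewrite fisher_integrandE; last 2 first.
- by rewrite mulr_ge0// (nbhs_singleton (reg_ge0 _ _)).
- by move=> c; exact: derivableM (reg_derivable rP Px) (reg_derivable rQ Qx).
rewrite !partial_odot//.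
rewrite (reg_fisher_integrandE _ _ rP Px) (reg_fisher_integrandE _ _ rQ Qx) /=.
(* Where one density vanishes, so do its partial derivatives; this kills the cross terms, and both
   sides are 0. Elsewhere the identity is one of fractions. *)
have [P0|P0] := eqVneq (dens P (lsubmx x) theta) 0.
  by rewrite !(partial_eq0 _ rP Px)// P0 !(mul0r, mulr0, invr0, addr0).
have [Q0|Q0] := eqVneq (dens Q (rsubmx x) theta) 0.
  by rewrite !(partial_eq0 _ rQ Qx)// Q0 !(mul0r, mulr0, invr0, addr0).
by field; apply/andP.
Qed.

(** * Additivity for a product of two factors *)

Section odot.
Variables P Q : spatial_fun R m.
Hypotheses (rP : regular_at P) (rQ : regular_at Q).
Let mu := leb (odot P Q).
Let D := sdom (odot P Q).

Let mD : measurable D.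
Proof.
rewrite -[X in measurable X]setTI.
exact: (measurable_split_rV measurableT
  (measurableX (reg_measurable rP) (reg_measurable rQ))).
Qed.

Let integrable_odotM f g :
  (leb P).-integrable (sdom P) (EFin \o f) ->
  (leb Q).-integrable (sdom Q) (EFin \o g) ->
  mu.-integrable D (fun x => (f (lsubmx x) * g (rsubmx x))%:E).
Proof.
move=> intf intg.
apply: (integrable_preimageM (m1 := leb P) (m2 := leb Q)
  (@measurable_split_rV R (sdim P) (sdim Q))) => //; try exact: reg_measurable.
exact: lebesgue_rV_setX.
Qed.

Let integral_odotM f g :
  (leb P).-integrable (sdom P) (EFin \o f) ->
  (leb Q).-integrable (sdom Q) (EFin \o g) ->
  (\int[mu]_(x in D) (f (lsubmx x) * g (rsubmx x))%:E =
   \int[leb P]_(x in sdom P) (f x)%:E * \int[leb Q]_(y in sdom Q) (g y)%:E)%E.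
Proof.
move=> intf intg.
apply: (integral_preimageM (m1 := leb P) (m2 := leb Q)
  (@measurable_split_rV R (sdim P) (sdim Q))) => //; try exact: reg_measurable.
exact: lebesgue_rV_setX.
Qed.

(** In these names, [d] marks the partial derivative and [F] the Fisher integrand of the factor
    whose letter follows. *)
Let int_pq := integrable_odotM (reg_integrable rP) (reg_integrable rQ).
Let int_dpq a :=
  integrable_odotM (reg_partial_integrable rP a) (reg_integrable rQ).
Let int_pdq a :=
  integrable_odotM (reg_integrable rP) (reg_partial_integrable rQ a).
Let int_dpdq a b :=
  integrable_odotM (reg_partial_integrable rP a) (reg_partial_integrable rQ b).
Let int_Fpq a b :=
  integrable_odotM (reg_fisher_integrable rP a b) (reg_integrable rQ).
Let int_pFq a b :=
  integrable_odotM (reg_integrable rP) (reg_fisher_integrable rQ a b).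

(** This closure property lets factors be appended one by one. By the product rule, the integral of
    a partial derivative is 0 times 1 plus 1 times 0. *)
Lemma regular_odot : regular_at (odot P Q).
Proof.
split.
- exact: mD.
- move=> x [Px Qx]; near=> t; apply: mulr_ge0.
    by near: t; exact: reg_ge0.
  by near: t; exact: reg_ge0.
- move=> a x [Px Qx].
  exact: derivableM (reg_derivable rP Px) (reg_derivable rQ Qx).
- exact: int_pq.
- rewrite (integral_odotM (reg_integrable rP) (reg_integrable rQ)).
  by rewrite (reg_integral rP) (reg_integral rQ) mule1.
- move=> a; apply: eq_integrable (integrableD mD (int_dpq a) (int_pdq a)) => //.
  by move=> x; rewrite inE => Dx; rewrite /= partial_odot.
- move=> a.
  under eq_integral => x do [rewrite inE => Dx; rewrite partial_odot// EFinD].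
  rewrite (integralD mD (int_dpq a) (int_pdq a)).
  rewrite (integral_odotM (reg_partial_integrable rP a) (reg_integrable rQ)).
  rewrite (integral_odotM (reg_integrable rP) (reg_partial_integrable rQ a)).
  by rewrite !reg_partial_integral// mul0e mule0 adde0.
- move=> a b; apply: eq_integrable (integrable_sum4 mD
    (int_Fpq a b) (int_dpdq a b) (int_dpdq b a) (int_pFq a b)) => //.
  by move=> x; rewrite inE => Dx; rewrite /= fisher_integrand_odot.
Unshelve. all: by end_near. Qed.

Lemma fisher_odot a b :
  fisher (odot P Q) a b theta = (fisher P a b theta + fisher Q a b theta)%E.
Proof.
rewrite /fisher.
under eq_integral => x do [rewrite inE => Dx; rewrite fisher_integrand_odot//].
rewrite (integral_sum4 mD
  (int_Fpq a b) (int_dpdq a b) (int_dpdq b a) (int_pFq a b)).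
rewrite (integral_odotM (reg_fisher_integrable rP a b) (reg_integrable rQ)).
rewrite (integral_odotM (reg_partial_integrable rP a) (reg_partial_integrable rQ b)).
rewrite (integral_odotM (reg_partial_integrable rP b) (reg_partial_integrable rQ a)).
rewrite (integral_odotM (reg_integrable rP) (reg_fisher_integrable rQ a b)).
by rewrite (reg_integral rP) (reg_integral rQ) !reg_partial_integral//
  mule1 mul1e mule0 !adde0.
Qed.

End odot.

(** * Iterated products *)

Lemma fisher_odot_pow P e : regular_at P -> (0 < e)%N ->
  regular_at (odot_pow P e) /\
  forall a b, fisher (odot_pow P e) a b theta = (e%:R%:E * fisher P a b theta)%E.
Proof.
(* [odot_pow] iterates [e.-1] times, so the induction starts from the single factor [P]. Regularity
   is carried along because [fisher_odot] requires it of both factors. *)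
move=> rP; case: e => // e _; elim: e => [|e [IHr IH]].
  by split => // a b; rewrite mul1e.
split; first exact: regular_odot.
move=> a b; rewrite [LHS](fisher_odot IHr rP) IH.
(* Distributivity in the extended reals is justified by the two coefficients being nonnegative. *)
by rewrite -[in RHS]natr1 EFinD ge0_muleDl ?mul1e ?lee_fin.
Qed.

Lemma fisher_foldl_odot (I : Type) (s : seq I) (Q : I -> spatial_fun R m) P :
  regular_at P -> (forall i, regular_at (Q i)) ->
  forall a b, fisher (foldl (@odot R m) P [seq Q i | i <- s]) a b theta =
    (fisher P a b theta + \sum_(i <- s) fisher (Q i) a b theta)%E.
Proof.
(* The accumulator [P] is generalized, since each step of [foldl] replaces it by a larger
   product. *)
move=> + rQ; elim: s P => [|i s IH] P rP a b /=.
  by rewrite big_nil adde0.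
by rewrite IH ?fisher_odot ?big_cons ?addeA//; exact: regular_odot.
Qed.

Lemma fisher_bigodot r (Q : 'I_r.+1 -> spatial_fun R m) :
  (forall i, regular_at (Q i)) ->
  forall a b, fisher (bigodot Q) a b theta =
    (\sum_(i < r.+1) fisher (Q i) a b theta)%E.
Proof.
by move=> rQ a b; rewrite fisher_foldl_odot// big_ord_recl big_enum.
Qed.

End fisher_information.

Theorem theorem4p2 (R : realType) (m : nat) (M : set 'rV[R]_m) (hM : open M)
    (r : nat) (P : 'I_r.+1 -> spatial_fun R m) (e : 'I_r.+1 -> nat)
    (hP : forall i, is_pdf_family M (P i))
    (hg : forall i, fisher_converges M (P i))
    (he : forall i, (0 < e i)%N) :
  forall (a b : 'I_m) (theta : 'rV[R]_m), M theta ->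
    fisher (bigodot (fun i => odot_pow (P i) (e i))) a b theta =
    (\sum_(i < r.+1) (e i)%:R%:E * fisher (P i) a b theta)%E.
Proof.
move=> a b theta Mt.
have rP i : regular_at theta (P i) by exact: pdf_family_regular_at (hP i) (hg i).
rewrite fisher_bigodot; last by move=> i; have [] := fisher_odot_pow (rP i) (he i).
by apply: eq_bigr => i _; have [_ ->] := fisher_odot_pow (rP i) (he i).
Qed.
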